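(* Let $A$ be a finite alphabet and $L \subseteq A^*$. The following properties are equivalent: (1) $L \in \mathrm{MSO}[\le,\mathrm{Arb}_1]$, i.e. there exist an MSO sentence $\varphi(P_1,\ldots,P_\ell)$ and monadic predicates $\mathbf{P}_1,\ldots,\mathbf{P}_\ell$ with $L = L_{\varphi,\mathbf{P}_1,\ldots,\mathbf{P}_\ell}$; (2) $L$ is recognized by a non-deterministic automaton with advice; (3) $L$ is recognized by a deterministic automaton with advice; (4) there exists $K \in \mathbb{N}$ such that for all $i,p \in \mathbb{N}$, the restriction of the equivalence relation $\sim_{L,p}$ to the words of length $i$ has at most $K$ equivalence classes; (5) $L$ is recognized by a one-scan program.
   Context: Words are $u = u_0\cdots u_{n-1}$ with positions $0,\ldots,n-1$. A (numerical) monadic predicate is a family $\mathbf{P} = (\mathbf{P}_n)_{n\in\mathbb{N}}$ with $\mathbf{P}_n \subseteq \{0,\ldots,n-1\}$; $\mathrm{Arb}_1$ is the class of all such predicates (no computability assumption). MSO formulae are built by $\varphi ::= \mathbf{a}(x) \mid x \le y \mid P(x) \mid \varphi\wedge\varphi \mid \neg\varphi \mid \exists x\,\varphi \mid \exists X\,\varphi$, with first-order variables ranging over positions, second-order variables over sets of positions, $\mathbf{a}(x)$ meaning position $x$ carries letter $a$, $\le$ the order on positions, and for a word $u$ of length $n$, $P(y)$ holds iff the position $y$ belongs to $\mathbf{P}_n$, where $\mathbf{P}$ interprets the symbol $P$. For a sentence $\varphi(P_1,\dots,P_\ell)$ and predicates $\mathbf{P}_1,\dots,\mathbf{P}_\ell$,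 $L_{\varphi,\mathbf{P}_1,\ldots,\mathbf{P}_\ell} = \{u \in A^* \mid u,\mathbf{P}_1,\ldots,\mathbf{P}_\ell \models \varphi\}$. A non-deterministic automaton with advice is $\mathcal{A} = (Q,q_0,\delta,F)$ with $Q$ finite, $q_0\in Q$, $\delta \subseteq \mathbb{N}\times\mathbb{N}\times Q\times A\times Q$ and $F \subseteq \mathbb{N}\times Q$; it is deterministic if $\delta$ is a function $\mathbb{N}\times\mathbb{N}\times Q\times A \to Q$. A run on $u = u_0\cdots u_{n-1}$ is $q_0 q_1\cdots q_n \in Q^*$ with $(i,n,q_i,u_i,q_{i+1}) \in \delta$ for all $i<n$; it is accepting if $(n,q_n)\in F$; $\mathcal{A}$ recognizes the set of words having an accepting run. A one-scan program is $(M,(f_{i,n}: A \to M)_{i,n\in\mathbb{N}},S)$ with $M$ a finite monoid and $S\subseteq M$; it accepts $u = u_0\cdots u_{n-1}$ iff $f_{0,n}(u_0)\cdots f_{n-1,n}(u_{n-1}) \in S$. For $p\in\mathbb{N}$, $u \sim_{L,p} v$ iff for all $w \in A^p$: $uw\in L \Leftrightarrow vw \in L$. *)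

(* Defs.v *)
From mathcomp Require Import all_boot.
From mathcomp Require Import boolp classical_sets.

Set Implicit Arguments.
Unset Strict Implicit.
Unset Printing Implicit Defensive.

Local Open Scope classical_set_scope.

(* An arbitrary family P_n of subsets of {0, ..., n-1}. *)
Definition monadic_predicate := forall n : nat, {set 'I_n}.

(* MSO formulae over the alphabet A with l monadic predicate symbols, at most
   n free first-order variables and at most m free second-order variables.
   Variables are de Bruijn indices: index ord0 refers to the innermost
   quantifier of the relevant sort.  MIn x X is the atom X(x), where X is a
   set variable; MPred P x is the atom P(x), where P is a predicate symbol. *)
Inductive mso (A : Type) (l n m : nat) : Type :=
| MLetter of A & 'I_n
| MLeq of 'I_n & 'I_n
| MPred of 'I_l & 'I_n
| MIn of 'I_n & 'I_m
| MAnd of mso A l n m & mso A l n m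
| MNot of mso A l n m
| MEx1 of mso A l n.+1 m
| MEx2 of mso A l n m.+1.

Definition mso_sentence (A : Type) (l : nat) := mso A l 0 0.

Fixpoint satisfies (A : finType) (l : nat) (P : 'I_l -> monadic_predicate)
    (u : seq A) (n m : nat) (phi : mso A l n m) :
    n.-tuple 'I_(size u) -> m.-tuple {set 'I_(size u)} -> Prop :=
  match phi with
  | MLetter a x => fun e _ => tnth (in_tuple u) (tnth e x) = a
  | MLeq x y => fun e _ => tnth e x <= tnth e y
  | MPred k x => fun e _ => tnth e x \in P k (size u)
  | MIn x X => fun e E => tnth e x \in tnth E X
  | MAnd f g => fun e E => satisfies P f e E /\ satisfies P g e E
  | MNot f => fun e E => ~ satisfies P f e E
  | MEx1 f => fun e E =>
      exists i : 'I_(size u), satisfies P f [tuple of i :: e] E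
  | MEx2 f => fun e E =>
      exists I : {set 'I_(size u)}, satisfies P f e [tuple of I :: E]
  end.

Definition mso_language (A : finType) (l : nat) (phi : mso_sentence A l)
    (P : 'I_l -> monadic_predicate) : set (seq A) :=
  [set u | @satisfies A l P u 0 0 phi [tuple] [tuple]].

Definition MSO_Arb1 (A : finType) : set (set (seq A)) :=
  [set L | exists (l : nat) (phi : mso_sentence A l)
                  (P : 'I_l -> monadic_predicate), L = mso_language phi P].

Arguments MSO_Arb1 A _ : clear implicits.

(* A tuple (i, n, q, a, q') of the transition relation is read as: at
   position i of a word of length n. *)
Record advice_automaton (A : finType) := AdviceAutomaton {
  state : finType;
  init : state;
  delta : set (nat * nat * state * A * state);
  final : set (nat * state) }.

Arguments delta {A} _ _.
Arguments final {A} _ _.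

(* The transition relation is the graph of a (total) function. *)
Definition deterministic (A : finType) (M : advice_automaton A) : Prop :=
  forall (i n : nat) (q : state M) (a : A),
    exists! q' : state M, delta M (i, n, q, a, q').

Definition is_run (A : finType) (M : advice_automaton A) (u : seq A)
    (r : seq (state M)) : Prop :=
  [/\ size r = (size u).+1,
      nth (init M) r 0 = init M &
      forall i : 'I_(size u),
        delta M (nat_of_ord i, size u, nth (init M) r i,
                 tnth (in_tuple u) i, nth (init M) r i.+1)].

Definition accepting (A : finType) (M : advice_automaton A) (u : seq A)
    (r : seq (state M)) : Prop :=
  final M (size u, nth (init M) r (size u)).

Definition automaton_language (A : finType) (M : advice_automaton A) :
    set (seq A) :=
  [set u | exists r : seq (state M), is_run u r /\ accepting u r].

Record one_scan_program (A : finType) := OneScanProgram {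
  monoid : finType;
  one : monoid;
  mul : Monoid.law one;
  instr : nat -> nat -> A -> monoid;
  accept_set : {set monoid} }.

Definition program_language (A : finType) (p : one_scan_program A) :
    set (seq A) :=
  [set u | \big[mul p / one p]_(i < size u)
             instr p i (size u) (tnth (in_tuple u) i) \in accept_set p].

Definition sim (A : finType) (L : set (seq A)) (p : nat) (u v : seq A) : Prop :=
  forall w : p.-tuple A, L (u ++ w) <-> L (v ++ w).

(* The set of equivalence classes of sim L p restricted to words of length i. *)
Definition sim_classes (A : finType) (L : set (seq A)) (i p : nat) :
    {set {set i.-tuple A}} :=
  equivalence_partition (fun u v : i.-tuple A => `[< sim L p u v >]) finset.setT.

(* Main.v *)
Require Import Defs.
From HB Require Import structures.
From mathcomp Require Import all_boot.
From mathcomp Require Import boolp classical_sets.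
From mathcomp Require Import zify.

Set Implicit Arguments.
Unset Strict Implicit.
Unset Printing Implicit Defensive.

(** All five properties are compared with a bounded-index condition: a finite
    invariant h p u of the words u determines, among words of equal length,
    which words w of length p satisfy u w \in L. It is closed under Boolean
    operations and letter-to-letter images, so it holds for MSO formulae by
    induction, free variables being written on extra tracks of the word.
    Conversely, the classes are the states of a deterministic automaton with
    advice, and the transformations of its states form the monoid of a one-scan
    program. Finally an MSO formula guesses, for each monoid element m, the set
    X_m of positions whose prefix has product m. *)

(** * The bounded-index condition and its closure properties *)

(** The finite set [T] serves all lengths at once, while [h] may depend arbitrarily on the length of
    the prefix and on that of the suffix: this leaves room for advice. The value of [h] need only
    refine the equivalence, not name its classes. *)
Definition finite_index (B : Type) (L : seq B -> Prop) : Prop :=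
  exists (T : finType) (h : nat -> seq B -> T),
  forall (u v w : seq B), size u = size v -> h (size w) u = h (size w) v ->
    L (u ++ w) <-> L (v ++ w).

Lemma finite_index_ext (B : Type) (L L' : seq B -> Prop) :
  (forall w, L w <-> L' w) -> finite_index L -> finite_index L'.
Proof.
move=> LL' [T [h hP]]; exists T, h => u v w suv huv.
by rewrite -!LL'; apply: hP.
Qed.

Lemma finite_index_not (B : Type) (L : seq B -> Prop) :
  finite_index L -> finite_index (fun w => ~ L w).
Proof.
by move=> [T [h hP]]; exists T, h => u v w suv /(hP _ _ _ suv) LE; rewrite LE.
Qed.

Lemma finite_index_and (B : Type) (L L' : seq B -> Prop) :
  finite_index L -> finite_index L' -> finite_index (fun w => L w /\ L' w).
Proof.
move=> [T [h hP]] [T' [h' hP']]; exists (T * T')%type, (fun p u => (h p u, h' p u)).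
move=> u v w suv [/(hP _ _ _ suv) LE /(hP' _ _ _ suv) LE'].
by rewrite LE LE'.
Qed.

(* A class of the image is described by the set of classes of its preimages. *)
Lemma finite_index_map (B C : Type) (f : B -> C) (L : seq B -> Prop) :
  finite_index L -> finite_index (fun w => exists2 x, map f x = w & L x).
Proof.
move=> [T [h hP]].
pose H p u := [ffun t => `[< exists2 x, map f x = u & h p x = t >]].
exists {ffun T -> bool}, H.
have Himp u v w : size u = size v -> H (size w) u = H (size w) v ->
    (exists2 x, map f x = u ++ w & L x) -> exists2 x, map f x = v ++ w & L x.
  move=> suv Huv [x fx].
  have fu : map f (take (size u) x) = u by rewrite map_take fx take_size_cat.
  have fw : map f (drop (size u) x) = w by rewrite map_drop fx drop_size_cat.
  rewrite -{1}(cat_take_drop (size u) x).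
  move: (take _ _) (drop _ _) fu fw => x1 x2 fu fw Lx.
  (* The class of the prefix [x1] is also reached by a preimage [y] of [v], which can replace [x1]
     in front of [x2]. *)
  have : H (size w) v (h (size w) x1).
    by rewrite -Huv ffunE; apply/asboolP; exists x1.
  rewrite ffunE => /asboolP[y fy hy].
  exists (y ++ x2); first by rewrite map_cat fy fw.
  apply/(hP y x1 x2) => //.
    by rewrite -[LHS](size_map f) -[RHS](size_map f) fy fu.
  by rewrite -(size_map f x2) fw.
by move=> u v w suv Huv; split; apply: Himp.
Qed.

(** One bit suffices: whether the prefix already contains a witness. A witness in the suffix keeps
    its position and the total length when the prefix is replaced by one of equal length, so [R] may
    be arbitrary. *)
Lemma finite_index_exists_letter (B : Type) (R : nat -> nat -> B -> Prop) :
  finite_index (fun w => exists i b, onth w i = Some b /\ R i (size w) b).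
Proof.
pose H p u := `[< exists i b, onth u i = Some b /\ R i (size u + p) b >].
exists bool, H.
have Himp u v w : size u = size v -> H (size w) u = H (size w) v ->
    (exists i b, onth (u ++ w) i = Some b /\ R i (size (u ++ w)) b) ->
    exists i b, onth (v ++ w) i = Some b /\ R i (size (v ++ w)) b.
  move=> suv Huv [i [b []]]; rewrite onth_cat size_cat; case: ltnP => iu ib Rb.
    have : H (size w) v by rewrite -Huv; apply/asboolP; exists i, b.
    move=> /asboolP[j [c [jc Rc]]]; exists j, c; rewrite onth_cat size_cat.
    by rewrite -onthTE jc.
  by exists i, b; rewrite onth_cat size_cat -suv ltnNge iu.
by move=> u v w suv Huv; split; apply: Himp.
Qed.

Lemma finite_index_before (B : Type) (x y : pred B) :
  finite_index (fun w => exists i j b c,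
    [/\ onth w i = Some b, onth w j = Some c, x b, y c & i <= j]).
Proof.
(* [has y] is tested on [w] rather than on its tail, which allows the two positions to coincide. *)
pose fix before w := if w is b :: w' then x b && has y w || before w' else false.
have beforeE w : before w <-> exists i j b c,
    [/\ onth w i = Some b, onth w j = Some c, x b, y c & i <= j].
  split.
    elim: w => //= b w IH /orP[/andP[xb /orP[yb|/(has_nthP b) [j jw yj]]]|/IH].
    - by exists 0, 0, b, b.
    - exists 0, j.+1, b, (nth b w j); split=> //=.
      have := onthTE w j; rewrite jw; case E: (onth w j) => [c|//] _.
      by rewrite (onth_nth _ _ _ _ E).
    - by move=> [i [j [c [d [? ? ? ? ?]]]]]; exists i.+1, j.+1, c, d.
  elim: w => [|a w IH] [i [j [b [c []]]]]; first by rewrite onth0n.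
  case: i => [|i]; case: j => [|j] //=.
  - by move=> [->] [->] -> ->.
  - move=> [->] jc -> yc _; rewrite (_ : has y w) ?orbT //.
    apply/(has_nthP b); exists j; first by rewrite -onthTE jc.
    by rewrite (onth_nth b _ _ _ jc).
  - move=> ib jc xb yc ij; rewrite IH ?orbT //.
    by exists i, j, b, c.
apply: (finite_index_ext beforeE).
(* The two positions lie both in [u], one on each side, or both in [w]; hence two bits about [u]
   suffice. *)
have before_cat u w : before (u ++ w) =
    [|| before u, has x u && has y w | before w].
  elim: u => //= b u ->; rewrite has_cat.
  by case: (x b); case: (y b); case: (has y u); case: (has x u);
     case: (has y w); case: (before u); case: (before w).
exists (bool * bool)%type, (fun _ u => (before u, has x u)).
by move=> u v w _ [E1 E2]; rewrite !before_cat E1 E2.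
Qed.

(** Counts can be truncated at 2, since only a total of exactly 1 matters. This recognizes the words
    in which every first-order track carries a single mark. *)
Lemma finite_index_count1 (B : Type) (I : finType) (a : I -> pred B) :
  finite_index (fun w => forall x, count (a x) w = 1).
Proof.
exists {ffun I -> 'I_3}, (fun _ u => [ffun x => inord (minn 2 (count (a x) u))]).
move=> u v w _ /ffunP E.
have {}E x : minn 2 (count (a x) u) = minn 2 (count (a x) v).
  have := congr1 (@nat_of_ord 3) (E x); rewrite !ffunE !inordK //; lia.
by split=> H x; have := H x; have := E x; rewrite !count_cat; lia.
Qed.

(** * Bounded index and the number of classes of [sim] *)

Lemma sim_sym (A : finType) (L : set (seq A)) p u v : sim L p u v -> sim L p v u.
Proof. by move=> uv w; rewrite uv. Qed.

Lemma sim_trans (A : finType) (L : set (seq A)) p v u w :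
  sim L p u v -> sim L p v w -> sim L p u w.
Proof. by move=> uv vw x; rewrite uv. Qed.

Lemma finite_index_sim_classes (A : finType) (L : set (seq A)) :
  finite_index L -> exists K, forall i p, #|sim_classes L i p| <= K.
Proof.
move=> [T [h hP]]; exists #|T| => i p.
have hsim (u v : i.-tuple A) : h p u = h p v -> sim L p u v.
  by move=> E w; apply: hP; rewrite !size_tuple.
(* The class of [u] is [G (h p u)], so all classes lie in the image of [G], which has at most [#|T|]
   elements. *)
pose G t := finset (fun v : i.-tuple A =>
  `[< exists2 u : i.-tuple A, h p u = t & sim L p u v >]).
apply: leq_trans (leq_imset_card G T).
apply/subset_leq_card/fintype.subsetP => _ /imsetP[u _ ->].
apply/imsetP; exists (h p u) => //; apply/setP => v; rewrite !inE /=.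
apply/asboolP/asboolP => [uv|[u' /hsim u'u u'v]]; first by exists u.
exact: sim_trans (sim_sym u'u) u'v.
Qed.

Lemma sim_classes_finite_index (A : finType) (L : set (seq A)) :
  (exists K, forall i p, #|sim_classes L i p| <= K) -> finite_index L.
Proof.
move=> [K KP].
pose cl i p u := finset (fun v : i.-tuple A => `[< sim L p u v >]).
(* A class is named by its rank in the enumeration for its lengths; ranks are at most [K], so
   [inord] into ['I_K.+1] loses nothing. *)
pose h p u : 'I_K.+1 := inord (index (cl (size u) p u) (enum (sim_classes L (size u) p))).
exists 'I_K.+1, h => u v w suv huv.
suff uv : sim L (size w) u v by exact: (uv (in_tuple w)).
have inC x : size x = size u ->
    cl (size u) (size w) x \in enum (sim_classes L (size u) (size w)).
  move/eqP=> sx; rewrite mem_enum; apply/imsetP; exists (Tuple sx) => //.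
  by apply/setP => y; rewrite !inE.
have idx x : size x = size u ->
    index (cl (size u) (size w) x) (enum (sim_classes L (size u) (size w))) < K.+1.
  move=> sx; rewrite ltnS; apply: leq_trans (index_size _ _) _.
  by rewrite -cardE; apply: KP.
have := congr1 (@nat_of_ord _) huv; rewrite /h -suv !inordK ?idx // => E.
have Ecl : cl (size u) (size w) u = cl (size u) (size w) v.
  rewrite -(nth_index finset.set0 (inC u erefl)) E nth_index //; exact: inC.
have : in_tuple u \in cl (size u) (size w) v by rewrite -Ecl inE; apply/asboolP.
by rewrite inE => /asboolP vu; apply: sim_sym vu.
Qed.

(** * Runs of automata with advice *)

(** Here [u] is a factor starting at position [i] of a word of total length [n]; keeping both lets a
    run be cut at any position. *)
Fixpoint reaches (A : finType) (M : advice_automaton A) n i (q : state M)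
    (u : seq A) (q' : state M) : Prop :=
  if u is a :: v then
    exists2 q1, delta M (i, n, q, a, q1) & reaches n i.+1 q1 v q'
  else q = q'.

Lemma reaches_cat (A : finType) (M : advice_automaton A) n i (q : state M) u v q' :
  reaches n i q (u ++ v) q' <->
  exists2 q1, reaches n i q u q1 & reaches n (i + size u) q1 v q'.
Proof.
elim: u i q => [|a u IH] i q /=.
  by rewrite addn0; split=> [?|[? -> //]]; exists q.
split=> [[q1 d /IH[q2 r r']]|[q2 [q1 d r] r']].
  by exists q2; [exists q1|rewrite addnS].
by exists q1 => //; apply/IH; exists q2; rewrite ?addSnnS.
Qed.

Lemma reachesP (A : finType) (M : advice_automaton A) n i (q : state M) u q' :
  reaches n i q u q' <-> exists r, [/\ size r = size u, last q r = q' &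
    forall j a, onth u j = Some a ->
      delta M (i + j, n, nth (init M) (q :: r) j, a, nth (init M) (q :: r) j.+1)].
Proof.
elim: u i q => [|a u IH] i q /=.
  split=> [->|[r [/size0nil -> /= -> //]]].
  by exists [::]; split=> // j a; rewrite onth0n.
split=> [[q1 d /IH[r [sr lr rP]]]|[[|q1 r] [//= [sr] lr rP]]].
  exists (q1 :: r); split=> //=; first by rewrite sr.
  case=> [|j] b /=; first by case=> <-; rewrite addn0.
  by move=> /rP; rewrite addSnnS.
exists q1; first by have := rP 0 a erefl; rewrite addn0.
apply/IH; exists r; split=> // j b jb.
by have := rP j.+1 b jb; rewrite addSnnS.
Qed.

Lemma automaton_languageP (A : finType) (M : advice_automaton A) u :
  automaton_language M u <->
  exists2 q, reaches (size u) 0 (init M) u q & final M (size u, q).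
Proof.
split=> [[r [[sr r0 rP] Fr]]|[q /reachesP[r [sr lr rP]] Fq]].
  case: r sr r0 rP Fr => //= q r [sr] qE rP Fr; subst q.
  exists (last (init M) r); last by rewrite (last_nth (init M)) sr.
  apply/reachesP; exists r; split=> // j a ja.
  have ju : j < size u by rewrite -onthTE ja.
  have := rP (Ordinal ju); rewrite (_ : tnth _ _ = a) //.
  by apply/tnth_onth.
exists (init M :: r); split.
  split=> //=; first by rewrite sr.
  by move=> i; have := rP i (tnth (in_tuple u) i); apply; apply/(tnth_onth _ (in_tuple u)).
by rewrite /accepting -sr -last_nth lr sr.
Qed.

(** Subset construction: the invariant is the set of states reachable after the prefix, the total
    length being known as [size u + p]. *)
Lemma finite_index_automaton (A : finType) (M : advice_automaton A) :
  finite_index (automaton_language M).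
Proof.
pose h p u := [ffun q => `[< reaches (size u + p) 0 (init M) u q >]].
exists {ffun state M -> bool}, h => u v w suv /ffunP huv.
have {}huv q : reaches (size u + size w) 0 (init M) u q <->
    reaches (size u + size w) 0 (init M) v q.
  have := huv q; rewrite !ffunE -suv => E.
  by split=> /asboolP r; apply/asboolP; [rewrite -E|rewrite E].
rewrite !automaton_languageP !size_cat -suv.
split=> -[q /reaches_cat[q1 r r'] Fq]; exists q => //; apply/reaches_cat;
  exists q1; try exact/huv; by rewrite -?suv in r' *.
Qed.

(** * From bounded index to deterministic automata *)

Fixpoint scan (A Q : Type) (step : nat -> nat -> Q -> A -> Q) n i q (u : seq A) : Q :=
  if u is a :: v then scan step n i.+1 (step i n q a) v else q.

(* The state is the class of the prefix read so far; since this class need not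
   determine the class of a one-letter extension, the step extends a chosen
   representative of it. *)
Lemma finite_index_scan (A : finType) (L : set (seq A)) : finite_index L ->
  exists (Q : finType) (q0 : Q) (step : nat -> nat -> Q -> A -> Q)
    (F : nat -> Q -> Prop), forall u, L u <-> F (size u) (scan step (size u) 0 q0 u).
Proof.
move=> [T [h hP]].
(* The default [[::]] is returned when no word of length [i] has class [t]. *)
pose rep i p t : seq A := xget [::] (fun v => size v = i /\ h p v = t).
(* After position [i] is read, [n - i.+1] letters remain. *)
pose step i n t a := h (n - i.+1) (rcons (rep i (n - i) t) a).
exists T, (h 0 [::]), step, (fun n t => L (rep n 0 t)) => u.
have repP v p : size (rep (size v) p (h p v)) = size v /\
    h p (rep (size v) p (h p v)) = h p v.
  by apply: (@xgetPex _ [::] (fun x => size x = size v /\ h p x = h p v)); exists v.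
(* Invariant: the representative of the current state has the length of the prefix [u] and may
   replace it in front of every suffix of the remaining length. *)
have scanP v : forall u t, size (rep (size u) (size v) t) = size u ->
    (forall w, size w = size v -> L (u ++ w) <-> L (rep (size u) (size v) t ++ w)) ->
    L (u ++ v) <->
    L (rep (size u + size v) 0 (scan step (size u + size v) (size u) t v)).
  elim: v => [|a v IH] {}u t st uP.
    by have := uP [::] erefl; rewrite /= !cats0 addn0.
  set x := rcons (rep (size u) (size v).+1 t) a.
  have sx : size x = size (rcons u a) by rewrite !size_rcons st.
  have stepE : step (size u) (size u + (size v).+1) t a = h (size v) x.
    by rewrite /step /x; congr (h _ (rcons (rep _ _ _) _)); lia.
  have [sr hr] := repP x (size v); rewrite sx in sr hr.
  rewrite -cat_rcons /= stepE addnS -addSn -(size_rcons u a).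
  apply: IH => // w sw.
  have := hP (rep (size (rcons u a)) (size v) (h (size v) x)) x w.
  rewrite sr sx sw hr => /(_ erefl erefl) ->.
  by rewrite !cat_rcons; apply: uP; rewrite /= sw.
(* At length 0 a representative and the default are both the empty word, so the invariant holds at
   the start. *)
have rep0 p t : rep 0 p t = [::].
  by rewrite /rep; case: xgetP => // v _ [/size0nil].
by apply: (scanP u [::]) => [|w _]; rewrite /= rep0.
Qed.

Lemma reaches_scan (A Q : finType) (q0 : Q) (step : nat -> nat -> Q -> A -> Q)
    (D : set (nat * nat * Q * A * Q)) (F : set (nat * Q)) n i q u q' :
  (forall i n q a q', D (i, n, q, a, q') <-> step i n q a = q') ->
  @reaches A (AdviceAutomaton q0 D F) n i q u q' <-> scan step n i q u = q'.
Proof.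
move=> DP; elim: u i q => [|a u IH] i q //=.
split=> [[q1 /DP <- /IH]|E] //.
by exists (step i n q a); [apply/DP|apply/IH].
Qed.

Lemma finite_index_deterministic (A : finType) (L : set (seq A)) :
  finite_index L ->
  exists M : advice_automaton A, deterministic M /\ L = automaton_language M.
Proof.
move=> /finite_index_scan[Q [q0 [step [F LP]]]].
pose D : set (nat * nat * Q * A * Q) :=
  fun x => let: (i, n, q, a, q') := x in step i n q a = q'.
exists (AdviceAutomaton q0 D (fun x => F x.1 x.2)); split.
  by move=> i n q a; exists (step i n q a).
apply/funext => u; apply/propext; rewrite LP automaton_languageP.
have rE q : @reaches A (AdviceAutomaton q0 D (fun x => F x.1 x.2)) (size u) 0 q0 u q
    <-> scan step (size u) 0 q0 u = q by apply: reaches_scan.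
split=> [Fu|[q /rE <- //]].
by exists (scan step (size u) 0 q0 u); rewrite ?rE.
Qed.

(** * Words with tracks for the free variables *)

(** Each letter carries one bit per first-order variable and one bit per set variable. *)
Definition marked (A : Type) (n m : nat) : Type :=
  (A * {ffun 'I_n -> bool} * {ffun 'I_m -> bool})%type.

Definition marks1 (A : Type) n m (x : 'I_n) : pred (marked A n m) :=
  fun b => b.1.2 x.

Definition mark (A : Type) (u : seq A) n m (e : n.-tuple 'I_(size u))
    (E : m.-tuple {set 'I_(size u)}) : seq (marked A n m) :=
  [seq (tnth (in_tuple u) i, [ffun x => tnth e x == i],
        [ffun X => i \in tnth E X]) | i <- enum 'I_(size u)].

Lemma size_mark (A : Type) (u : seq A) n m (e : n.-tuple 'I_(size u))
    (E : m.-tuple {set 'I_(size u)}) : size (mark e E) = size u.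
Proof. by rewrite size_map size_enum_ord. Qed.

Lemma onth_mark (A : Type) (u : seq A) n m (e : n.-tuple 'I_(size u))
    (E : m.-tuple {set 'I_(size u)}) (i : 'I_(size u)) :
  onth (mark e E) i = Some (tnth (in_tuple u) i, [ffun x => tnth e x == i],
        [ffun X => i \in tnth E X]).
Proof.
rewrite onth_map (_ : onth _ _ = Some i) //.
have /= := onthTE (enum 'I_(size u)) i.
rewrite size_enum_ord ltn_ord; case E0: onth => [j|//] _.
by rewrite -(onth_nth i _ _ _ E0) nth_ord_enum.
Qed.

Lemma letters_mark (A : Type) (u : seq A) n m (e : n.-tuple 'I_(size u))
    (E : m.-tuple {set 'I_(size u)}) : map (fun b => b.1.1) (mark e E) = u.
Proof.
by rewrite -map_comp -[RHS](map_tnth_enum (in_tuple u)); apply: eq_map.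
Qed.

Lemma mark_inj (A : Type) (u : seq A) n m (e e' : n.-tuple 'I_(size u))
    (E E' : m.-tuple {set 'I_(size u)}) :
  mark e E = mark e' E' -> e = e' /\ E = E'.
Proof.
move=> EE; have EEi i : onth (mark e E) i = onth (mark e' E') i by rewrite EE.
split; apply: eq_from_tnth => x.
  have := EEi (tnth e x); rewrite !onth_mark => -[/ffunP/(_ x) + _].
  by rewrite !ffunE eqxx => /esym/eqP.
apply/setP => i; have := EEi i; rewrite !onth_mark => -[_ /ffunP/(_ x)].
by rewrite !ffunE.
Qed.

(** A valuation is read back from the tracks: [e] takes the first mark of each first-order track,
    which is the only one, and [E] collects all marks of each set track. *)
Lemma markP (A : Type) n m (w : seq (marked A n m)) :
  (forall x, count (marks1 x) w = 1) <->
  exists (u : seq A) (e : n.-tuple 'I_(size u)) (E : m.-tuple {set 'I_(size u)}),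
    mark e E = w.
Proof.
split=> [w1|[u [e [E <-]]] x]; last first.
  rewrite count_map /= (eq_count (a2 := pred1 (tnth e x))); last first.
    by move=> i /=; rewrite /marks1 ffunE eq_sym.
  by rewrite count_uniq_mem ?enum_uniq // mem_enum.
pose u := map (fun b => b.1.1) w.
have su : size u = size w by rewrite size_map.
have fu x : find (marks1 x) w < size u.
  by rewrite su -has_find has_count w1.
pose e := mktuple (fun x => Ordinal (fu x)).
pose E := mktuple (fun X : 'I_m => finset (fun i : 'I_(size u) =>
  if onth w i is Some b then b.2 X else false)).
exists u, e, E; apply: eq_from_onth => i.
have [ui|iu] := leqP (size u) i.
  by rewrite !onth_default // ?size_mark // -su.
rewrite -[i]/(val (Ordinal iu)) onth_mark /=.
have := onthTE w i; rewrite -su iu; case wi: (onth w i) => [[[a f] g]|//] _.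
congr (Some (_, _, _)).
- by apply/tnth_onth; rewrite onth_map /= wi.
- apply/ffunP => x; rewrite !ffunE tnth_mktuple -val_eqE /=.
  apply/eqP/idP => [fE|fx].
    have : has (marks1 x) w by rewrite has_count w1.
    by move=> /(nth_find (a, f, g)); rewrite fE (onth_nth _ _ _ _ wi).
  (* a marked position other than the first one would give a second mark *)
  apply/eqP; rewrite eqn_leq leqNgt; apply/andP; split.
    by apply/negP => /(before_find (a, f, g)); rewrite (onth_nth _ _ _ _ wi) /= /marks1 /= fx.
  rewrite leqNgt; apply/negP => lt_fi.
  have hw : has (marks1 x) w by rewrite has_count w1.
  have := w1 x; rewrite -(cat_take_drop i w) count_cat.
  have := has_take i hw; rewrite lt_fi has_count.
  rewrite (drop_nth (a, f, g)) -?su // (onth_nth _ _ _ _ wi) /= /marks1 /= fx; lia.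
- by apply/ffunP => X; rewrite !ffunE tnth_mktuple inE /= wi.
Qed.

(** * Bounded index of MSO languages *)

Definition marked_language (A : finType) l (P : 'I_l -> monadic_predicate)
    n m (phi : mso A l n m) (w : seq (marked A n m)) : Prop :=
  exists (u : seq A) (e : n.-tuple 'I_(size u)) (E : m.-tuple {set 'I_(size u)}),
    mark e E = w /\ satisfies P phi e E.

Lemma marked_languageE (A : finType) l (P : 'I_l -> monadic_predicate)
    n m (phi : mso A l n m) u (e : n.-tuple 'I_(size u)) E :
  marked_language P phi (mark e E) <-> satisfies P phi e E.
Proof.
split=> [[u' [e' [E' [EE]]]]|]; last by exists u, e, E.
have uu : u' = u by rewrite -(letters_mark e E) -EE letters_mark.
by subst u'; have [-> ->] := mark_inj EE.
Qed.

(** [L] and [L'] need only agree on encodings of valuations, since intersecting [L] with the words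
    having one mark per track preserves bounded index. This matters for negation, where the
    complement also contains words that encode nothing. *)
Lemma finite_index_marked (A : finType) n m (L L' : seq (marked A n m) -> Prop) :
  (forall (u : seq A) (e : n.-tuple 'I_(size u)) E, L (mark e E) <-> L' (mark e E)) ->
  (forall w, L' w -> forall x, count (marks1 x) w = 1) ->
  finite_index L -> finite_index L'.
Proof.
move=> LL' L'1 /finite_index_and /(_ (finite_index_count1 (@marks1 A n m))).
apply: finite_index_ext => w; split=> [[Lw /markP[u [e [E wE]]]]|L'w].
  by rewrite -wE -LL' wE.
have w1 := L'1 w L'w; split=> //.
by have /markP[u [e [E wE]]] := w1; rewrite -wE LL' wE.
Qed.

Lemma finite_index_marked_language (A : finType) l (P : 'I_l -> monadic_predicate)
    n m (phi : mso A l n m) : finite_index (marked_language P phi).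
Proof.
have count1 k j (f : mso A l k j) w : marked_language P f w ->
    forall x, count (marks1 x) w = 1.
  by move=> [u [e [E [wE _]]]]; apply/markP; exists u, e, E.
(* Atoms about a single variable [x] ask for a letter marked by [x] with a property of its position,
   the word length and the letter. *)
have atom k j (f : mso A l k j) x (R : nat -> nat -> marked A k j -> Prop) :
    (forall u (e : k.-tuple 'I_(size u)) (E : j.-tuple {set 'I_(size u)}),
      satisfies P f e E <->
      R (tnth e x) (size u) (tnth (in_tuple u) (tnth e x),
          [ffun y => tnth e y == tnth e x], [ffun X => tnth e x \in tnth E X])) ->
    finite_index (marked_language P f).
  move=> fP; pose R' i s (b : marked A k j) := b.1.2 x /\ R i s b.
  apply: finite_index_marked (count1 _ _ f) (finite_index_exists_letter R').
  move=> u e E; rewrite marked_languageE fP; split.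
    move=> [i [b [ib [bx Rb]]]].
    have iu : i < size u by rewrite -(size_mark e E) -onthTE ib.
    move: ib bx Rb; rewrite -[i]/(val (Ordinal iu)) onth_mark size_mark => -[<-].
    by rewrite ffunE => /eqP ->.
  move=> Rb; exists (tnth e x); eexists; rewrite onth_mark; split; first by [].
  by rewrite /R' size_mark /= ffunE.
elim: phi => {n m}
  [n m a x|n m x y|n m k x|n m x X|n m f IHf g IHg|n m f IH|n m f IH|n m f IH].
- by apply: (atom _ _ _ x (fun _ _ b => b.1.1 = a)).
- apply: finite_index_marked (count1 _ _ _)
    (finite_index_before (marks1 x) (marks1 y)).
  move=> u e E; rewrite marked_languageE /=; split.
    move=> [i [j [b [c [ib jc]]]]].
    have iu : i < size u by rewrite -(size_mark e E) -onthTE ib.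
    have ju : j < size u by rewrite -(size_mark e E) -onthTE jc.
    move: ib jc; rewrite -[i]/(val (Ordinal iu)) -[j]/(val (Ordinal ju)) !onth_mark.
    by move=> [<-] [<-]; rewrite /marks1 /= !ffunE => /eqP -> /eqP ->.
  move=> exy; exists (tnth e x), (tnth e y); do 2 eexists.
  by rewrite !onth_mark; split; [reflexivity|reflexivity|rewrite /marks1 /= ffunE..|].
- apply: (atom _ _ _ x (fun i s _ => exists2 j : 'I_s, j = i :> nat & j \in P k s)).
  move=> u e E /=; split=> [?|[j /val_inj ->]] //; by exists (tnth e x).
- by apply: (atom _ _ _ x (fun _ _ b => b.2 X)) => u e E /=; rewrite ffunE.
- apply: finite_index_marked (count1 _ _ _) (finite_index_and IHf IHg).
  by move=> u e E; rewrite !marked_languageE.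
- apply: finite_index_marked (count1 _ _ _) (finite_index_not IH).
  by move=> u e E; rewrite !marked_languageE.
(* Quantification erases the track of the innermost variable, a letter-to-letter image; [lift ord0]
   skips that track. *)
- apply: finite_index_ext (finite_index_map (fun b : marked A n.+1 m =>
    (b.1.1, [ffun x => b.1.2 (lift ord0 x)], b.2)) IH) => w.
  have dropE u (e : n.-tuple 'I_(size u)) (E : m.-tuple {set 'I_(size u)}) i :
      map (fun b : marked A n.+1 m => (b.1.1, [ffun x => b.1.2 (lift ord0 x)], b.2))
        (mark [tuple of i :: e] E) = mark e E.
    rewrite -map_comp; apply: eq_map => j /=; congr (_, _, _).
    by apply/ffunP => x; rewrite !ffunE tnthS.
  split.
    move=> [_ <- [u [e [E [<- fP]]]]].
    rewrite (tuple_eta e) in fP *.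
    by rewrite dropE; apply/marked_languageE; exists (thead e).
  move=> [u [e [E [<- [i fP]]]]]; exists (mark [tuple of i :: e] E) => //.
  exact/marked_languageE.
- apply: finite_index_ext (finite_index_map (fun b : marked A n m.+1 =>
    (b.1, [ffun x => b.2 (lift ord0 x)])) IH) => w.
  have dropE u (e : n.-tuple 'I_(size u)) (E : m.-tuple {set 'I_(size u)}) I :
      map (fun b : marked A n m.+1 => (b.1, [ffun x => b.2 (lift ord0 x)]))
        (mark e [tuple of I :: E]) = mark e E.
    rewrite -map_comp; apply: eq_map => j /=; congr (_, _).
    by apply/ffunP => x; rewrite !ffunE tnthS.
  split.
    move=> [_ <- [u [e [E [<- fP]]]]].
    rewrite (tuple_eta E) in fP *.
    by rewrite dropE; apply/marked_languageE; exists (thead E).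
  move=> [u [e [E [<- [I fP]]]]]; exists (mark e [tuple of I :: E]) => //.
  exact/marked_languageE.
Qed.

Lemma finite_index_MSO_Arb1 (A : finType) (L : set (seq A)) :
  MSO_Arb1 A L -> finite_index L.
Proof.
move=> [l [phi [P ->]]].
have := finite_index_map (fun b : marked A 0 0 => b.1.1)
  (finite_index_marked_language P phi).
apply: finite_index_ext => u; split=> [[w wu [v [e [E [vw sat]]]]]|sat].
  have uv : v = u by rewrite -wu -vw letters_mark.
  by subst v; rewrite (tuple0 e) (tuple0 E) in sat.
by exists (@mark _ u 0 0 [tuple] [tuple]); [apply: letters_mark|apply/marked_languageE].
Qed.

(** * From bounded index to one-scan programs *)

(* The accepting set of a program does not depend on the length of the word, so
   the last instruction evaluates the acceptance condition, which is stored in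
   the [bool] summand of the set on which the monoid acts; only the empty word
   leaves the initial state in the left summand. *)
Lemma finite_index_program (A : finType) (L : set (seq A)) :
  finite_index L -> exists M : one_scan_program A, L = program_language M.
Proof.
move=> /finite_index_scan[Q [q0 [step [F LP]]]].
pose T := {ffun Q + bool -> Q + bool}.
pose one : T := [ffun q => q].
(* Composition in reading order: the left factor acts first. *)
pose mul (f g : T) : T := [ffun q => g (f q)].
have mulA : associative mul by move=> f g k; apply/ffunP => q; rewrite !ffunE.
have mul1 : left_id one mul by move=> f; apply/ffunP => q; rewrite !ffunE.
have mulr1 : right_id one mul by move=> f; apply/ffunP => q; rewrite !ffunE.
pose mulM := HB.pack_for (Monoid.law one) mul
  (Monoid.isLaw.Build T one mul mulA mul1 mulr1).
pose ins i n a : T := [ffun q => if q is inl q then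
   if i.+1 == n then inr `[< F n (step i n q a) >] else inl (step i n q a) else q].
pose S : {set T} := finset (fun f : T =>
  match f (inl q0) with inl q => `[< F 0 q >] | inr b => b end).
exists (@OneScanProgram A T one mulM ins S).
apply/funext => u; apply/propext; rewrite LP /program_language /= inE.
have prodE v : forall i q, v != [::] ->
    (\big[mul/one]_(j < size v) ins (i + j) (i + size v) (tnth (in_tuple v) j)) (inl q)
    = inr `[< F (i + size v) (scan step (i + size v) i q v) >].
  elim: v => // a v IH i q _; rewrite /= big_ord_recl ffunE /= addn0 ffunE.
  have [->|v0] := eqVneq v [::]; first by rewrite big_ord0 /= addn1 eqxx ffunE.
  have sv : 0 < size v by rewrite lt0n size_eq0.
  rewrite ifN; last by rewrite -addSnnS -[X in X != _]addn0 eqn_add2l eq_sym -lt0n.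
  rewrite -addSnnS -IH //; rewrite (tnth_nth a) /=; congr (fun_of_fin _ _).
  by apply: eq_bigr => j _; rewrite (_ : i.+1 + j = i + bump 0 j) ?addSnnS // !(tnth_nth a).
have [->|u0] := eqVneq u [::]; first by rewrite big_ord0 ffunE; split=> /asboolP.
by rewrite (prodE u 0 q0 u0); split=> /asboolP.
Qed.

(** * Derived MSO formulae and their semantics *)

(** The quantifier supplies a variable when none is free; the formula holds on the empty word
    too. *)
Definition mtrue (A : Type) l n m : mso A l n m :=
  MNot (MEx1 (MNot (MLeq A l m ord0 ord0))).

Definition mimp (A : Type) l n m (f g : mso A l n m) : mso A l n m :=
  MNot (MAnd f (MNot g)).

Definition mall (A : Type) l n m (f : mso A l n.+1 m) : mso A l n m :=
  MNot (MEx1 (MNot f)).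

Definition mconj (A : Type) l n m (I : finType) (F : I -> mso A l n m) :
  mso A l n m := foldr (@MAnd A l n m) (mtrue A l n m) [seq F i | i <- enum I].

Fixpoint mexs2 (A : Type) l n m : mso A l n m -> mso A l n 0 :=
  if m is m'.+1 then fun f => mexs2 (MEx2 f) else id.

Definition mfirst (A : Type) l n m (x : 'I_n) : mso A l n m :=
  mall (MLeq A l m (lift ord0 x) ord0).

Definition mlast (A : Type) l n m (x : 'I_n) : mso A l n m :=
  mall (MLeq A l m ord0 (lift ord0 x)).

Definition msucc (A : Type) l n m (x y : 'I_n) : mso A l n m :=
  MAnd (MNot (MLeq A l m y x))
    (mall (mimp (MNot (MLeq A l m ord0 (lift ord0 x))) (MLeq A l m (lift ord0 y) ord0))).

Lemma satisfies_mand (A : finType) l (P : 'I_l -> monadic_predicate) (u : seq A) n m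
    (e : n.-tuple 'I_(size u)) (E : m.-tuple {set 'I_(size u)}) f g :
  satisfies P (MAnd f g) e E <-> satisfies P f e E /\ satisfies P g e E.
Proof. by []. Qed.

Lemma satisfies_mtrue (A : finType) l (P : 'I_l -> monadic_predicate) (u : seq A) n m
    (e : n.-tuple 'I_(size u)) (E : m.-tuple {set 'I_(size u)}) :
  satisfies P (mtrue A l n m) e E.
Proof. by move=> [i /=]; rewrite leqnn. Qed.

Lemma satisfies_mimp (A : finType) l (P : 'I_l -> monadic_predicate) (u : seq A) n m
    (e : n.-tuple 'I_(size u)) (E : m.-tuple {set 'I_(size u)}) f g :
  satisfies P (mimp f g) e E <-> (satisfies P f e E -> satisfies P g e E).
Proof.
split=> [fg fE|fg [fE]]; last by apply; apply: fg.
by apply: contrapT => gE; apply: fg.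
Qed.

Lemma satisfies_mall (A : finType) l (P : 'I_l -> monadic_predicate) (u : seq A) n m
    (e : n.-tuple 'I_(size u)) (E : m.-tuple {set 'I_(size u)}) f :
  satisfies P (mall f) e E <-> forall i, satisfies P f [tuple of i :: e] E.
Proof.
split=> [fE i|fE [i]]; last by apply; apply: fE.
by apply: contrapT => fi; apply: fE; exists i.
Qed.

Lemma satisfies_mconj (A : finType) l (P : 'I_l -> monadic_predicate) (u : seq A) n m
    (e : n.-tuple 'I_(size u)) (E : m.-tuple {set 'I_(size u)}) (I : finType) F :
  satisfies P (@mconj A l n m I F) e E <-> forall i, satisfies P (F i) e E.
Proof.
rewrite /mconj; transitivity (forall i, i \in enum I -> satisfies P (F i) e E).
  elim: (enum I) => [|i s IH] /=.
    split=> [_ i|_]; first by rewrite in_nil.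
    exact: (@satisfies_mtrue _ _ P _ _ _ e E).
  split=> [[Fi /IH Fs] j|Fs].
    by rewrite inE => /orP[/eqP -> //|]; apply: Fs.
  split; first by apply: Fs; rewrite mem_head.
  by apply/IH => j js; apply: Fs; rewrite inE js orbT.
by split=> Fs i => [|_]; apply: Fs => //; rewrite mem_enum.
Qed.

Lemma satisfies_mexs2 (A : finType) l (P : 'I_l -> monadic_predicate) (u : seq A) n m
    (e : n.-tuple 'I_(size u)) (f : mso A l n m) :
  satisfies P (mexs2 f) e [tuple] <-> exists E : m.-tuple _, satisfies P f e E.
Proof.
elim: m f => [|m IH] f /=.
  by split=> [|[E]]; [exists [tuple]|rewrite (tuple0 E)].
rewrite IH; split=> [[E [I fE]]|[E fE]]; first by exists [tuple of I :: E].
by move: fE; rewrite (tuple_eta E); exists [tuple of behead E], (thead E).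
Qed.

Lemma satisfies_mfirst (A : finType) l (P : 'I_l -> monadic_predicate) (u : seq A) n m
    (e : n.-tuple 'I_(size u)) (E : m.-tuple {set 'I_(size u)}) x :
  satisfies P (mfirst A l m x) e E <-> tnth e x = 0 :> nat.
Proof.
have u0 : 0 < size u := leq_ltn_trans (leq0n _) (ltn_ord (tnth e x)).
rewrite satisfies_mall /=; split=> [/(_ (Ordinal u0))|x0 i].
  by rewrite tnth0 tnthS leqn0 => /eqP.
by rewrite tnth0 tnthS x0.
Qed.

Lemma satisfies_mlast (A : finType) l (P : 'I_l -> monadic_predicate) (u : seq A) n m
    (e : n.-tuple 'I_(size u)) (E : m.-tuple {set 'I_(size u)}) x :
  satisfies P (mlast A l m x) e E <-> (tnth e x).+1 = size u.
Proof.
have xu := ltn_ord (tnth e x).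
rewrite satisfies_mall /=; split=> [xM|xu' i]; last first.
  by rewrite tnth0 tnthS -ltnS xu'.
have pu : (size u).-1 < size u by lia.
by have := xM (Ordinal pu); rewrite tnth0 tnthS /=; lia.
Qed.

Lemma satisfies_msucc (A : finType) l (P : 'I_l -> monadic_predicate) (u : seq A) n m
    (e : n.-tuple 'I_(size u)) (E : m.-tuple {set 'I_(size u)}) x y :
  satisfies P (msucc A l m x y) e E <-> tnth e y = (tnth e x).+1 :> nat.
Proof.
rewrite /msucc satisfies_mand.
split=> [[nyx /satisfies_mall yP]|yx].
  have xu : (tnth e x).+1 < size u.
    by apply: leq_ltn_trans (ltn_ord (tnth e y)); rewrite ltnNge; apply/negP/nyx.
  have /satisfies_mimp /= := yP (Ordinal xu).
  rewrite !tnthS ltnn => /(_ notF) yx.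
  by apply/eqP; rewrite eqn_leq yx ltnNge; apply/negP/nyx.
split; first by rewrite /= yx ltnn.
apply/satisfies_mall => i; apply/satisfies_mimp => /=.
by rewrite !tnthS ?tnth0 yx ltnNge => /negP.
Qed.

(** * From one-scan programs to MSO *)

Lemma MSO_Arb1_program (A : finType) (L : set (seq A)) :
  (exists M : one_scan_program A, L = program_language M) -> MSO_Arb1 A L.
Proof.
move=> [[M one mul ins S] ->] /=.
pose code (m : M) : 'I_#|M| := enum_rank m.
pose sym (a : A) (m : M) : 'I_#|{: A * M}| := enum_rank (a, m).
(* The instruction table becomes finitely many monadic predicates: the one indexed by [(a, m)] holds
   where the instruction sends [a] to [m]. *)
pose P : 'I_#|{: A * M}| -> monadic_predicate := fun k n =>
  finset (fun i : 'I_n => ins i n (enum_val k).1 == (enum_val k).2).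
pose l := #|{: A * M}|; pose k := #|M|.
pose value n (x : 'I_n) (am : A * M) : mso A l n k :=
  MAnd (MLetter l k am.1 x) (MPred A k (sym am.1 am.2) x).
pose mem n (x : 'I_n) (m : M) : mso A l n k := MIn A l x (code m).
pose cst n (b : bool) : mso A l n k :=
  if b then mtrue A l n k else MNot (mtrue A l n k).
(* [f1] and [f2] only force lower bounds on the sets X_m, which need not be
   disjoint: [f3] then still forces the product of the whole word into [S]. *)
pose f0 : mso A l 0 k := mimp (MNot (MEx1 (MLeq A l k ord0 ord0))) (cst 0 (one \in S)).
pose f1 : mso A l 0 k := mall (mconj (fun am : A * M =>
  mimp (mfirst A l k ord0) (mimp (value 1 ord0 am) (mem 1 ord0 am.2)))).
(* Under two quantifiers [x1] is the outer position and [ord0] the inner one, required below to be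
   its successor. *)
pose x1 : 'I_2 := lift ord0 ord0.
pose f2 : mso A l 0 k := mall (mall (mconj (fun m : M => mconj (fun am : A * M =>
  mimp (msucc A l k x1 ord0) (mimp (mem 2 x1 m)
    (mimp (value 2 ord0 am) (mem 2 ord0 (mul m am.2)))))))).
pose f3 : mso A l 0 k := mall (mconj (fun m : M =>
  mimp (mlast A l k ord0) (mimp (mem 1 ord0 m) (cst 1 (m \in S))))).
exists l, (mexs2 (MAnd (MAnd f0 f1) (MAnd f2 f3))), P.
apply/funext => u; apply/propext; rewrite /mso_language /program_language /=.
have valueP n (e : n.-tuple 'I_(size u)) (E : k.-tuple {set 'I_(size u)}) x am :
    satisfies P (value n x am) e E <->
    tnth (in_tuple u) (tnth e x) = am.1 /\
    ins (tnth e x) (size u) (tnth (in_tuple u) (tnth e x)) = am.2.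
  rewrite /= inE enum_rankK /=.
  by split=> -[-> /eqP].
have memE n (e : n.-tuple 'I_(size u)) (E : k.-tuple {set 'I_(size u)}) x m :
    satisfies P (mem n x m) e E <-> tnth e x \in tnth E (code m) by [].
have cstP n (e : n.-tuple 'I_(size u)) (E : k.-tuple {set 'I_(size u)}) b :
    satisfies P (cst n b) e E <-> b.
  rewrite /cst; have T := @satisfies_mtrue _ _ P _ _ _ e E.
  by case: b; split=> //= /(_ T).
(* Extending the instructions by [one] beyond the word defines the prefix products [pre j] for every
   natural number [j]. *)
pose g j := if onth u j is Some a then ins j (size u) a else one.
pose pre j := \big[mul/one]_(i < j) g i.
have gE (i : 'I_(size u)) : g i = ins i (size u) (tnth (in_tuple u) i).
  by rewrite /g (iffLR (tnth_onth _ (in_tuple u) i) erefl).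
have preS j : pre j.+1 = mul (pre j) (g j) by rewrite /pre big_ord_recr.
have -> : \big[mul/one]_(i < size u) ins i (size u) (tnth (in_tuple u) i) = pre (size u).
  by apply: eq_bigr => i _; rewrite gE.
rewrite satisfies_mexs2.
split=> [uS|[E /satisfies_mand[/satisfies_mand[/satisfies_mimp f0E /satisfies_mall f1E]
  /satisfies_mand[/satisfies_mall f2E /satisfies_mall f3E]]]].
  (* The prefix at position [i] includes its own letter, hence [pre i.+1]. *)
  exists (mktuple (fun c => finset (fun i : 'I_(size u) => pre i.+1 == enum_val c))).
  have memP n (e : n.-tuple 'I_(size u)) x m :
      satisfies P (mem n x m) e (mktuple (fun c =>
        finset (fun i : 'I_(size u) => pre i.+1 == enum_val c))) <->
      pre (tnth e x).+1 = m.
    by rewrite /= tnth_mktuple inE enum_rankK; split=> /eqP.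
  rewrite !satisfies_mand; do 2 split.
  - apply/satisfies_mimp => u0; apply/cstP.
    have : size u = 0.
      case: (posnP (size u)) => // u1; case: u0; exists (Ordinal u1) => /=.
      by rewrite ?tnth0.
    by move=> s0; rewrite s0 /pre big_ord0 in uS.
  - apply/satisfies_mall => i; apply/satisfies_mconj => am.
    apply/satisfies_mimp => /satisfies_mfirst; rewrite ?tnth0 => i0.
    apply/satisfies_mimp => /valueP[_]; rewrite ?tnth0 => iE; apply/memP.
    by rewrite ?tnth0 preS gE iE i0 /pre big_ord0 Monoid.mul1m.
  - apply/satisfies_mall => i; apply/satisfies_mall => j.
    apply/satisfies_mconj => m; apply/satisfies_mconj => am.
    apply/satisfies_mimp => /satisfies_msucc; rewrite tnthS ?tnth0 => ij.
    apply/satisfies_mimp => /memP; rewrite tnthS ?tnth0 => im.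
    apply/satisfies_mimp => /valueP[_]; rewrite ?tnth0 => jE; apply/memP.
    by rewrite ?tnth0 preS gE jE ij im.
  - apply/satisfies_mall => i; apply/satisfies_mconj => m.
    apply/satisfies_mimp => /satisfies_mlast; rewrite ?tnth0 => i_last.
    apply/satisfies_mimp => /memP; rewrite ?tnth0 i_last => <-.
    exact/cstP.
(* Any sets satisfying [f1] and [f2] contain the intended ones. *)
have preE j (ju : j < size u) : Ordinal ju \in tnth E (code (pre j.+1)).
  elim: j ju => [|j IH] ju.
    have /satisfies_mconj/(_ (tnth (in_tuple u) (Ordinal ju), g 0)) := f1E (Ordinal ju).
    move=> /satisfies_mimp; rewrite satisfies_mfirst ?tnth0 => /(_ erefl).
    move=> /satisfies_mimp; rewrite valueP !tnth0 -gE => /(_ (conj erefl erefl)) /=.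
    by rewrite ?tnth0 preS /pre big_ord0 Monoid.mul1m.
  have ju' : j < size u := ltnW ju.
  have /satisfies_mall/(_ (Ordinal ju)) := f2E (Ordinal ju').
  move=> /satisfies_mconj/(_ (pre j.+1)) /satisfies_mconj.
  move=> /(_ (tnth (in_tuple u) (Ordinal ju), g j.+1)).
  move=> /satisfies_mimp; rewrite satisfies_msucc tnthS ?tnth0 => /(_ erefl).
  move=> /satisfies_mimp; rewrite memE tnthS ?tnth0 => /(_ (IH ju')).
  move=> /satisfies_mimp; rewrite valueP !tnth0 -gE => /(_ (conj erefl erefl)) /=.
  by rewrite ?tnth0 (preS j.+1).
(* The empty word has no last position, so [f0] decides it. *)
case: (posnP (size u)) => [s0|su].
  rewrite s0 /pre big_ord0; apply/(cstP _ _ E); apply: f0E => -[i _].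
  by move: (ltn_ord i); move: (nat_of_ord i) => j; rewrite s0.
have pu : (size u).-1 < size u by rewrite prednK.
have /satisfies_mconj/(_ (pre (size u))) := f3E (Ordinal pu).
move=> /satisfies_mimp; rewrite satisfies_mlast tnth0 prednK // => /(_ erefl).
move=> /satisfies_mimp; rewrite memE cstP tnth0; apply.
by have := preE _ pu; rewrite prednK.
Qed.

(** * The cycle of implications through bounded index *)

Theorem mainTheorem1 (A : finType) (L : set (seq A)) :
  [<-> MSO_Arb1 A L;
       exists M : advice_automaton A, L = automaton_language M;
       exists M : advice_automaton A,
         deterministic M /\ L = automaton_language M;
       exists K : nat, forall i p : nat, #|sim_classes L i p| <= K;
       exists M : one_scan_program A, L = program_language M].
Proof.
tfae.
- by move=> /finite_index_MSO_Arb1/finite_index_deterministic[M [_ LM]]; exists M.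
- by move=> [M ->]; apply/finite_index_deterministic/finite_index_automaton.
- by move=> [M [_ ->]]; apply/finite_index_sim_classes/finite_index_automaton.
- by move=> /sim_classes_finite_index/finite_index_program.
- exact: MSO_Arb1_program.
Qed.
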